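(* Let $g:\mathbb{R}^n\to\mathbb{R}$ be defined by $g(z)=\alpha h_\mu(a^\top z+b)$ with $a\in\mathbb{R}^n$, $b\in\mathbb{R}$, $\alpha\in\mathbb{R}_+$ and $h_\mu:\mathbb{R}\to\mathbb{R}_+$ the Huber loss defined, for a given $\mu>0$, by $$h_\mu(e)=\begin{cases}\dfrac{1}{2\mu}e^2 & \text{if }|e|\le\mu,\\[2mm] |e|-\dfrac{\mu}{2}&\text{otherwise.}\end{cases}$$ Then for all $x\in\mathbb{R}^n$, $$\mathrm{prox}_g(x)=x-\alpha\,\mathrm{Sat}_1\!\left(\frac{a^\top x+b}{\mu+\alpha\|a\|_2^2}\right)a.$$
   Context: The proximal operator of $f:\mathbb{R}^n\to\mathbb{R}$ is $\mathrm{prox}_f(x)=\operatorname*{arg\,min}_{z\in\mathbb{R}^n}\big[\tfrac12\|z-x\|_2^2+f(z)\big]$. $\mathrm{Sat}_1:\mathbb{R}\to\mathbb{R}$ is the saturation function: $\mathrm{Sat}_1(e)=\mathrm{sign}(e)$ if $|e|>1$ and $\mathrm{Sat}_1(e)=e$ if $|e|\le1$. $\mathbb{R}_+$ denotes the nonnegative reals. *)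

(* Defs.v *)
From mathcomp Require Import all_boot all_order all_algebra.
From mathcomp Require Import boolp classical_sets reals.

Set Implicit Arguments.
Unset Strict Implicit.
Unset Printing Implicit Defensive.

Import Order.TTheory GRing.Theory Num.Theory.

Local Open Scope classical_set_scope.
Local Open Scope ring_scope.

Definition dotp (R : realType) (n : nat) (u v : 'cV[R]_n) : R :=
  (u^T *m v) 0 0.

(* The Euclidean norm; MathComp-Analysis's [`|v|] on matrices is the sup norm. *)
Definition norm2 (R : realType) (n : nat) (v : 'cV[R]_n) : R :=
  Num.sqrt (\sum_(i < n) v i 0 ^+ 2).

Definition argmin (R : realType) (T : Type) (F : T -> R) : set T :=
  [set z | forall w, F z <= F w].

(* Set-valued: "the proximal point of f at x exists, is unique and equals p"
   reads [prox f x = [set p]]. *)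
Definition prox (R : realType) (n : nat) (f : 'cV[R]_n -> R) (x : 'cV[R]_n) :
    set 'cV[R]_n :=
  argmin (fun z => 2^-1 * norm2 (z - x) ^+ 2 + f z).

Definition Sat1 (R : realType) (e : R) : R :=
  if `|e| > 1 then Num.sg e else e.

Definition huber (R : realType) (mu e : R) : R :=
  if `|e| <= mu then (2 * mu)^-1 * e ^+ 2 else `|e| - mu / 2.

Lemma huber_ge0 (R : realType) (mu e : R) : 0 < mu -> 0 <= huber mu e.
Proof.
move=> mu0; rewrite /huber; case: ifPn => [_|].
  by rewrite mulr_ge0 ?sqr_ge0 // invr_ge0 mulr_ge0 // ltW.
rewrite -ltNge => /ltW mue; rewrite subr_ge0 (le_trans _ mue) //.
by rewrite ler_pdivrMr // ler_peMr ?ltW // ltr1n.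
Qed.

(* Main.v *)
Require Import Defs.
From mathcomp Require Import all_boot all_order all_algebra.
From mathcomp Require Import boolp classical_sets reals.
From mathcomp Require Import ring lra.

Import Order.TTheory GRing.Theory Num.Theory.

Local Open Scope classical_set_scope.
Local Open Scope ring_scope.

(** Two ideas carry the proof.

    If [x - p] is a subgradient of [f] at [p], then expanding the square
    around [p] gives
      [1/2 |z - x|^2 + f z >= 1/2 |p - x|^2 + f p + 1/2 |z - p|^2],
    so [p] is the unique minimizer ([prox_subgradient]). No convexity theory
    is involved: exhibiting the subgradient is enough.

    The Huber loss is the conjugate of [mu/2 s^2] restricted to [|s| <= 1]: it
    is the maximum over such [s] of [s e - mu/2 s^2] ([huber_ge_affine]),
    attained at [s = Sat1 (e / mu)] ([huber_Sat1]). Hence that [s] is a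
    subgradient at [e], and by composition [alpha s a] is a subgradient of [g]
    at any [p] with [e = <a, p> + b].

    For [p = x - alpha s a] this leaves the fixed-point equation
    [s = Sat1 ((<a, x> + b - alpha |a|^2 s) / mu)], whose solution is the
    claimed [s = Sat1 ((<a, x> + b) / (mu + alpha |a|^2))]. Indeed [Sat1] is the
    projection onto [[-1, 1]], and the two arguments of [Sat1] differ by a
    nonnegative multiple of the residual of that projection, which does not
    change the projected point ([Sat1_normal]). *)

Lemma dotpC {R : realType} {n : nat} (u v : 'cV[R]_n) : dotp u v = dotp v u.
Proof. by rewrite /dotp !mxE; apply: eq_bigr => i _; rewrite !mxE mulrC. Qed.

Lemma dotpDr {R : realType} {n : nat} (u v w : 'cV[R]_n) :
  dotp u (v + w) = dotp u v + dotp u w.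
Proof. by rewrite /dotp mulmxDr mxE. Qed.

Lemma dotpZr {R : realType} {n : nat} (c : R) (u v : 'cV[R]_n) :
  dotp u (c *: v) = c * dotp u v.
Proof. by rewrite /dotp -scalemxAr mxE. Qed.

Lemma dotpBr {R : realType} {n : nat} (u v w : 'cV[R]_n) :
  dotp u (v - w) = dotp u v - dotp u w.
Proof. by rewrite -scaleN1r dotpDr dotpZr mulN1r. Qed.

Lemma sqr_norm2 {R : realType} {n : nat} (v : 'cV[R]_n) :
  norm2 v ^+ 2 = dotp v v.
Proof.
rewrite /norm2 sqr_sqrtr; last by apply: sumr_ge0 => i _; apply: sqr_ge0.
by rewrite /dotp mxE; apply: eq_bigr => i _; rewrite !mxE expr2.
Qed.

Lemma norm2_eq0 {R : realType} {n : nat} (v : 'cV[R]_n) :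
  norm2 v = 0 -> v = 0.
Proof.
move=> v0; have := sqr_norm2 v.
rewrite v0 expr0n /= /dotp mxE => /esym/eqP.
rewrite psumr_eq0 => [/allP vi0|i _]; last by rewrite mxE -expr2 sqr_ge0.
apply/colP => i; have := vi0 i (mem_index_enum i).
by rewrite !mxE /= mulf_eq0 orbb => /eqP.
Qed.

Lemma sqr_norm2B {R : realType} {n : nat} (u v : 'cV[R]_n) :
  norm2 (u - v) ^+ 2 = norm2 u ^+ 2 - 2 * dotp v u + norm2 v ^+ 2.
Proof.
rewrite !sqr_norm2 dotpBr ![dotp (u - v) _]dotpC !dotpBr (dotpC u v).
ring.
Qed.

(** The quadratic term turns the subgradient inequality into the growth bound
    [F w >= F p + 1/2 |w - p|^2], which gives minimality of [p] and, since a
    second minimizer [w] would force [|w - p| = 0], uniqueness. *)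
Lemma prox_subgradient {R : realType} {n : nat} (f : 'cV[R]_n -> R)
    (x p : 'cV[R]_n) :
  (forall w, f p + dotp (x - p) (w - p) <= f w) -> prox f x = [set p].
Proof.
move=> subg; rewrite /prox /argmin.
have growth w : 2^-1 * norm2 (p - x) ^+ 2 + f p + 2^-1 * norm2 (w - p) ^+ 2
                <= 2^-1 * norm2 (w - x) ^+ 2 + f w.
  have -> : w - x = (w - p) - (x - p) by rewrite opprB addrA subrK.
  have -> : norm2 (p - x) ^+ 2 = norm2 (x - p) ^+ 2
    by rewrite !sqr_norm2B dotpC; ring.
  have := subg w; rewrite [norm2 (w - p - _) ^+ 2]sqr_norm2B.
  lra.
apply/seteqP; split => [z /= zmin|z /= -> w]; last first.
  have := growth w; have := sqr_ge0 (norm2 (w - p)); lra.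
apply/eqP; rewrite -subr_eq0; apply/eqP/norm2_eq0/eqP.
rewrite -sqrf_eq0 eq_le sqr_ge0 andbT.
have := growth z; have := zmin p; lra.
Qed.

Variant Sat1_spec {R : realType} (u : R) : R -> Prop :=
  | Sat1_inner of (-1 <= u) & (u <= 1) : Sat1_spec u u
  | Sat1_above of 1 < u : Sat1_spec u 1
  | Sat1_below of u < -1 : Sat1_spec u (-1).

Lemma Sat1P {R : realType} (u : R) : Sat1_spec u (Sat1 u).
Proof.
rewrite /Sat1; case: ifPn => [|].
  rewrite lter_normr => /orP[u1|u1].
    by rewrite gtr0_sg; [constructor|lra].
  by rewrite ltr0_sg; [constructor; lra|lra].
by rewrite -leNgt ler_norml => /andP[? ?]; constructor.
Qed.

Lemma normr_Sat1_le1 {R : realType} (u : R) : `|Sat1 u| <= 1.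
Proof. by rewrite ler_norml; case: Sat1P => *; lra. Qed.

(** [Sat1] is the projection onto [[-1, 1]], and [u - Sat1 u] is normal to that
    interval at [Sat1 u]: moving further along it keeps the projection. *)
Lemma Sat1_normal {R : realType} (u k : R) :
  0 <= k -> Sat1 (u + k * (u - Sat1 u)) = Sat1 u.
Proof.
move=> k0; case: (Sat1P u) => [u1 u2|u1|u1].
- rewrite subrr mulr0 addr0; case: Sat1P => *; lra.
- have ? : 0 <= k * (u - 1) by rewrite mulr_ge0 //; lra.
  by case: Sat1P => *; lra.
- have ? : 0 <= k * (-1 - u) by rewrite mulr_ge0 //; lra.
  by case: Sat1P => *; lra.
Qed.

(** On the quadratic branch the gap is [(e - mu s)^2 / (2 mu)]; on the linear
    one it is at least [(1 - |s|) (|e| - mu (1 + |s|) / 2)]. *)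
Lemma huber_ge_affine {R : realType} (mu e s : R) :
  0 < mu -> `|s| <= 1 -> s * e - mu / 2 * s ^+ 2 <= huber mu e.
Proof.
move=> mu0 s1; rewrite /huber; case: ifPn => [_|].
  rewrite -subr_ge0.
  have -> : (2 * mu)^-1 * e ^+ 2 - (s * e - mu / 2 * s ^+ 2)
            = (e - mu * s) ^+ 2 / (2 * mu) by field; lra.
  by rewrite divr_ge0 ?sqr_ge0 //; lra.
rewrite -ltNge => mue.
have se : s * e <= `|s| * `|e| by rewrite -normrM ler_norm.
have gap : 0 <= (1 - `|s|) * (`|e| - mu / 2 * (1 + `|s|)).
  by apply: mulr_ge0; nra.
rewrite -(real_normK (num_real s)); nra.
Qed.

Lemma huber_Sat1 {R : realType} (mu e : R) : 0 < mu ->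
  huber mu e = Sat1 (e / mu) * e - mu / 2 * Sat1 (e / mu) ^+ 2.
Proof.
move=> mu0.
have -> : huber mu e = huber mu (e / mu * mu) by rewrite divfK //; lra.
have {3}-> : e = e / mu * mu by rewrite divfK //; lra.
move: (e / mu) => u; rewrite /huber normrM (gtr0_norm mu0) ger_pMl //.
case: Sat1P => [u1 u2|u1|u1].
- by rewrite ler_norml u1 u2 /=; field; lra.
- by rewrite gtr0_norm; [rewrite leNgt u1 /=; lra|lra].
- by rewrite ltr0_norm; [rewrite leNgt ltrNr u1 /=; lra|lra].
Qed.

Lemma huber_subgradient {R : realType} (mu e e' : R) : 0 < mu ->
  huber mu e + Sat1 (e / mu) * (e' - e) <= huber mu e'.
Proof.
move=> mu0; have := huber_ge_affine mu e' _ mu0 (normr_Sat1_le1 (e / mu)).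
rewrite (huber_Sat1 _ e mu0); lra.
Qed.

(** Since [Sat1 (e / mu)] is the derivative of the Huber loss at [e], this says
    that [e = t - c * Sat1 (t / (mu + c))] solves [e + c * huber' e = t]: it is
    the one-dimensional proximal point of [c * huber mu] at [t]. *)
Lemma Sat1_resolvent {R : realType} (mu c t : R) : 0 < mu -> 0 <= c ->
  Sat1 ((t - c * Sat1 (t / (mu + c))) / mu) = Sat1 (t / (mu + c)).
Proof.
move=> mu0 c0; rewrite -[RHS](Sat1_normal _ (c / mu)).
  by congr Sat1; field; lra.
by rewrite divr_ge0 // ltW.
Qed.

Theorem lemma14 (R : realType) (n : nat) (a : 'cV[R]_n) (b alpha mu : R)
    (g : 'cV[R]_n -> R)
    (halpha : 0 <= alpha) (hmu : 0 < mu)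
    (hg : forall z : 'cV[R]_n, g z = alpha * huber mu (dotp a z + b)) :
  forall x : 'cV[R]_n,
    prox g x =
    [set x - (alpha * Sat1 ((dotp a x + b) / (mu + alpha * norm2 a ^+ 2))) *: a].
Proof.
move=> x; apply: prox_subgradient => w.
set s := Sat1 _; set p := x - _ *: a.
have sE : Sat1 ((dotp a p + b) / mu) = s.
  have c0 : 0 <= alpha * norm2 a ^+ 2 by rewrite mulr_ge0 ?sqr_ge0.
  rewrite -[RHS](Sat1_resolvent _ _ _ hmu c0); congr (Sat1 (_ / mu)).
  by rewrite /p dotpBr dotpZr -sqr_norm2 -/s; ring.
have -> : x - p = (alpha * s) *: a by rewrite /p subKr.
rewrite dotpC dotpZr dotpC dotpBr !hg.
have := huber_subgradient _ (dotp a p + b) (dotp a w + b) hmu.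
rewrite sE => /(ler_wpM2l halpha); lra.
Qed.
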